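(* There exists a function $g:\mathbb{N}\times\mathbb{N}\to\mathbb{N}$ such that for every finite field $\mathbb{F}$, every $d\in\mathbb{N}$ and every matrix $A$ over $\mathbb{F}$ with $m$ rows such that $\mathrm{csd}(M(A))=d$, the number of progressive vectors for $M(A)$, i.e. vectors $v\in\mathbb{F}^m$ with $\mathrm{csd}(M(A)/v)<\mathrm{csd}(M(A))$, is at most $g(|\mathbb{F}|,d)$.
   Context: For a matrix $A$ over $\mathbb{F}$ with $m$ rows and a subspace $K\subseteq\mathbb{F}^m$, $M(A,K)$ is the matroid on the columns of $A$ in which a set $\{u_1,\dots,u_\ell\}$ of columns is dependent iff there are $\alpha_1,\dots,\alpha_\ell\in\mathbb{F}$, not all $0$, with $\sum_i\alpha_iu_i\in K$. $M(A)=M(A,\{0\})$, and $M(A)/v=M(A,\mathrm{span}(v))$. A matroid is connected if any two elements lie in a common circuit; components are maximal connected restrictions. Contraction$^*$-depth: $\mathrm{csd}(A,K)=0$ if $M(A,K)$ has rank $0$; otherwise if $M(A,K)$ is disconnected, $\mathrm{csd}(A,K)=\max_C\mathrm{csd}(A_C,K)$ over components $C$ ($A_C$ the submatrix of columns of $C$); otherwise $\mathrm{csd}(A,K)=1+\min_{u\in\mathbb{F}^m}\mathrm{csd}(A,K+\mathrm{span}(u))$. We set $\mathrm{csd}(M(A))=\mathrm{csd}(A,\{0\})$ and $\mathrm{csd}(M(A)/v)=\mathrm{csd}(A,\mathrm{span}(v))$. *)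

(* Defs.v *)
From HB Require Import structures.
From mathcomp Require Import all_boot all_order all_algebra.
Set Implicit Arguments. Unset Strict Implicit. Unset Printing Implicit Defensive.
Import GRing.Theory.
Local Open Scope ring_scope.

(* Vectors of F^m are row vectors 'rV[F]_m; a subspace K of F^m is the row
   space of a square matrix K : 'M[F]_m.  The columns of A : 'M[F]_(m, n) are
   indexed by 'I_n; column j, as a vector of F^m, is (col j A)^T.
   A restriction A_E of A to a set of columns E is represented by E itself. *)
Section CSD.
Variables (F : finFieldType) (m n : nat) (A : 'M[F]_(m, n)).

Definition mdependent (K : 'M[F]_m) (S : {set 'I_n}) : bool :=
  [exists a : {ffun 'I_n -> F},
    [&& [forall j, (j \notin S) ==> (a j == 0)],
        [exists j, (j \in S) && (a j != 0)] &
        ((\sum_j a j *: trmx (col j A) : 'rV[F]_m)%R <= K)%MS]].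

Definition mcircuit (K : 'M[F]_m) (C : {set 'I_n}) : bool :=
  mdependent K C && [forall C' : {set 'I_n}, (C' \proper C) ==> ~~ mdependent K C'].

Definition mrank (K : 'M[F]_m) (E : {set 'I_n}) : nat :=
  \max_(S : {set 'I_n} | (S \subset E) && ~~ mdependent K S) #|S|.

Definition mconnected (K : 'M[F]_m) (E : {set 'I_n}) : bool :=
  [forall x in E, forall y in E, (x != y) ==>
     [exists C : {set 'I_n}, [&& C \subset E, mcircuit K C, x \in C & y \in C]]].

Definition mcomponent (K : 'M[F]_m) (E C : {set 'I_n}) : bool :=
  [&& C \subset E, mconnected K C &
      [forall C' : {set 'I_n}, ((C \proper C') && (C' \subset E)) ==> ~~ mconnected K C']].

(* csd_le d E K  <=>  csd(A_E, K) <= d, following the recursive definition: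
   0 if rank 0; max over components if disconnected; 1 + min_u csd(A_E, K+span u)
   otherwise.  The inner fuel (#|E|.+1) bounds the nesting of the
   "disconnected" case, which always passes to strictly smaller column sets. *)
Fixpoint csd_le (d : nat) (E : {set 'I_n}) (K : 'M[F]_m) {struct d} : bool :=
  let fix aux (f : nat) (E : {set 'I_n}) : bool :=
    match f with
    | 0 => false
    | f'.+1 =>
      (mrank K E == 0)%N ||
      (if mconnected K E then
         match d with
         | 0 => false
         | d'.+1 => [exists u : 'rV[F]_m, csd_le d' E (K + <<u>>)%MS]
         end
       else [forall C : {set 'I_n}, mcomponent K E C ==> aux f' C])
    end
  in aux #|E|.+1 E.

Definition csd_is (d : nat) (E : {set 'I_n}) (K : 'M[F]_m) : bool :=
  csd_le d E K && [forall d' : 'I_d, ~~ csd_le d' E K].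

Definition progressive (d : nat) (v : 'rV[F]_m) : bool :=
  [exists d' : 'I_d, csd_le d' setT <<v>>%MS].

End CSD.

(* Main.v *)
(* It suffices to find a bounded set S of columns whose csd is already d: a
   vector outside the span of S changes no linear relation on S, so it cannot be
   progressive, and the span of S has at most |F|^|S| elements.  Such an S is
   built by induction on the depth, keeping the size of circuits bounded: circuits
   of A have size at most 2^d, because adding a vector to K at worst halves a
   circuit.  The induction contracts a vector w in the span of a bounded set
   S0; this multiplies the bound on circuit sizes by at most 2^|S0|, because
   contracting all of S0 does not create longer circuits.  Sets of columns and
   contractions are handled through words: the coefficient vectors of linear
   combinations of columns, which are relations when the combination lies in K. *)
Require Import Defs.
From HB Require Import structures.
From mathcomp Require Import all_boot all_order all_algebra.
Import GRing.Theory.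
Set Implicit Arguments. Unset Strict Implicit. Unset Printing Implicit Defensive.
Local Open Scope ring_scope.

(** * Words, their supports, and relations modulo a subspace *)

Section Words.
Variables (F : finFieldType) (m n : nat) (A : 'M[F]_(m, n)).
Implicit Types (a b c x y : 'rV[F]_n) (K : 'M[F]_m) (u : 'rV[F]_m).
Implicit Types (S E C D : {set 'I_n}).

Definition supp a : {set 'I_n} := [set j | a 0 j != 0].

Definition rel_word K a : bool := (a *m A^T <= K)%MS.

Lemma in_supp a j : (j \in supp a) = (a 0 j != 0).
Proof. by rewrite inE. Qed.

Lemma supp_eq0 a : (supp a == set0) = (a == 0).
Proof.
apply/eqP/eqP => [a0|->]; last by apply/setP=> j; rewrite !inE mxE eqxx.
apply/rowP=> j; rewrite mxE; apply/eqP/negPn.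
by rewrite -in_supp a0 inE.
Qed.

Lemma supp_neq0P a : reflect (exists j, j \in supp a) (a != 0).
Proof. by rewrite -supp_eq0; apply: set0Pn. Qed.

Lemma supp_sub S a j : supp a \subset S -> j \notin S -> a 0 j = 0.
Proof.
move=> /subsetP sa; apply: contraNeq => aj; apply: sa; by rewrite in_supp.
Qed.

Lemma suppP S a : (forall j, j \notin S -> a 0 j = 0) -> supp a \subset S.
Proof.
by move=> h; apply/subsetP=> j; rewrite in_supp; apply: contraNT => /h ->.
Qed.

Lemma supp_lin S a b l :
  supp a \subset S -> supp b \subset S -> supp (a - l *: b) \subset S.
Proof.
move=> sa sb; apply: suppP => j jS.
by rewrite !mxE (supp_sub sa jS) (supp_sub sb jS) mulr0 subrr.
Qed.

Lemma supp_delta j : supp (delta_mx 0 j : 'rV[F]_n) = [set j].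
Proof.
apply/setP=> i; rewrite in_supp inE mxE eqxx /=.
by case: (i == j); rewrite ?oner_eq0 ?eqxx.
Qed.

Lemma card_words S : (#|[set a | supp a \subset S]| <= #|F| ^ #|S|)%N.
Proof.
pose f a := [ffun i : 'I_#|S| => a 0 (enum_val i)].
have injf : {in [set a | supp a \subset S] &, injective f}.
  move=> a b; rewrite !inE => sa sb /ffunP eqf; apply/rowP=> j.
  have [jS|jS] := boolP (j \in S); last by rewrite (supp_sub sa jS) (supp_sub sb jS).
  by have := eqf (enum_rank_in jS j); rewrite !ffunE enum_rankK_in.
rewrite -(card_in_imset injf); apply: leq_trans (max_card _) _.
by rewrite card_ffun card_ord.
Qed.

Lemma rel_lin K a b l :
  rel_word K a -> rel_word K b -> rel_word K (a - l *: b).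
Proof.
rewrite /rel_word => ra rb; rewrite mulmxBl -scalemxAl.
by rewrite addmx_sub // eqmx_opp scalemx_sub.
Qed.

Lemma sub_add_lineP K u (v : 'rV[F]_m) :
  reflect (exists l, (v - l *: u <= K)%MS) (v <= K + <<u>>)%MS.
Proof.
apply: (iffP idP) => [/sub_addsmxP[[p r] /= ->]|[l vK]].
  have : (r *m <<u>> <= u)%MS by rewrite -(genmxE u) submxMl.
  by case/sub_rVP=> l ->; exists l; rewrite addrK submxMl.
rewrite -[v](subrK (l *: u)); apply: addmx_sub_adds => //.
by rewrite genmxE scalemx_sub.
Qed.

Lemma rel_add_wordP K a b :
  reflect (exists l, rel_word K (a - l *: b))
          (rel_word (K + <<b *m A^T>>)%MS a).
Proof.
apply: (iffP (sub_add_lineP _ _ _)) => -[l h]; exists l;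
  by move: h; rewrite /rel_word mulmxBl -scalemxAl.
Qed.

Lemma rel_addl K u a : rel_word K a -> rel_word (K + <<u>>)%MS a.
Proof. by move=> h; apply: submx_trans h (addsmxSl _ _). Qed.

Lemma mdependentP K S :
  reflect (exists a, [/\ a != 0, supp a \subset S & rel_word K a])
          (mdependent A K S).
Proof.
have E (a : 'rV[F]_n) : a *m A^T = \sum_j a 0 j *: (col j A)^T.
  rewrite mulmx_sum_row; apply: eq_bigr => j _; congr (_ *: _).
  by apply/rowP=> i; rewrite !mxE.
apply: (iffP existsP) => [[f /and3P[/forallP f0 /existsP[j /andP[jS fj]] fK]]|].
  exists (\row_j f j); split.
  - by apply/supp_neq0P; exists j; rewrite in_supp mxE.
  - by apply: suppP => i iS; rewrite mxE; apply/eqP/(implyP (f0 i)).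
  - by rewrite /rel_word E; under eq_bigr do rewrite mxE.
case=> a [/supp_neq0P[j ja] sa ra]; exists [ffun j => a 0 j]; apply/and3P; split.
- by apply/forallP=> i; apply/implyP=> iS; rewrite ffunE (supp_sub sa iS).
- by apply/existsP; exists j; rewrite (subsetP sa) //= ffunE -in_supp.
- by under eq_bigr do rewrite ffunE; rewrite -E.
Qed.

(** * Circuits as words: elimination and halving *)

(** These are the elementary vectors of the space of relations; [mcircuitP] identifies their
    supports with the circuits. *)
Definition circ K a : bool :=
  [&& a != 0, rel_word K a &
    [forall b, [&& b != 0, rel_word K b & supp b \subset supp a]
               ==> (supp a \subset supp b)]].

Lemma circP K a :
  reflect [/\ a != 0, rel_word K a &
    forall b, b != 0 -> rel_word K b -> supp b \subset supp a ->
      supp a \subset supp b] (circ K a).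
Proof.
apply: (iffP and3P) => -[a0 ra h]; split=> //.
  move=> b b0 rb sb; apply: (implyP (forallP h b)); exact/and3P.
by apply/forallP=> b; apply/implyP=> /and3P[*]; apply: h.
Qed.

Lemma mcircuitP K C : reflect (exists2 a, circ K a & supp a = C) (mcircuit A K C).
Proof.
apply: (iffP andP) => [[/mdependentP[a [a0 sa ra]] /forallP minC]|].
  have min b : b != 0 -> rel_word K b -> supp b \subset C -> supp b = C.
    move=> b0 rb sb; apply/eqP/negPn; apply/negP=> nb.
    have pb : supp b \proper C by rewrite properEneq nb.
    have /negP := implyP (minC (supp b)) pb; apply.
    by apply/mdependentP; exists b.
  have sC := min a a0 ra sa.
  exists a => //; apply/circP; split=> // b b0 rb.
  by rewrite sC => /(min b b0 rb) ->.
case=> a /circP[a0 ra min] <-; split.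
  by apply/mdependentP; exists a.
apply/forallP=> C'; apply/implyP=> /properP[sC [j ja jC]].
apply/negP=> /mdependentP[b [b0 sb rb]].
have := subsetP (min b b0 rb (subset_trans sb sC)) j ja.
by move=> /(subsetP sb); rewrite (negbTE jC).
Qed.

Lemma supp_cancel a b j : j \in supp b -> supp b \subset supp a ->
  supp (a - (a 0 j / b 0 j) *: b) \proper supp a.
Proof.
move=> jb sb; apply/properP; split; first exact: supp_lin.
exists j; first exact: (subsetP sb).
by rewrite in_supp !mxE divfK ?subrr ?eqxx // -in_supp.
Qed.

(** Cancelling with [a] a coordinate of [b] in [supp a] leaves a relation supported properly inside
    [supp a], which must vanish. *)
Lemma circ_uniq K a b : circ K a -> rel_word K b -> supp b \subset supp a ->
  exists l, b = l *: a.
Proof.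
move=> /circP[/supp_neq0P[j ja] ra min] rb sb; exists (b 0 j / a 0 j).
apply/eqP; rewrite -subr_eq0; apply/negPn/negP => c0.
have := min _ c0 (rel_lin _ rb ra) (supp_lin _ sb (subxx _)).
by move=> /subsetP/(_ j ja); rewrite in_supp !mxE divfK ?subrr ?eqxx // -in_supp.
Qed.

(** A smaller relation [z] inside [supp x] either contains [i], and the search continues in [z], or
    misses [i], and then subtracting a multiple of [z] shrinks [x] without touching coordinate
    [i]. *)
Lemma circ_through K x i : rel_word K x -> i \in supp x ->
  exists c, [/\ circ K c, i \in supp c & supp c \subset supp x].
Proof.
have [k] := ubnP #|supp x|; elim: k x => // k IH x; rewrite ltnS => ltk rx ix.
have x0 : x != 0 by apply/supp_neq0P; exists i.
have [cx|] := boolP (circ K x); first by exists x.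
rewrite /circ x0 rx /= negb_forall => /existsP[z].
rewrite negb_imply => /andP[/and3P[z0 rz sz] nsz].
have pz : supp z \proper supp x by rewrite properE sz.
have [iz|iz] := boolP (i \in supp z).
  have [c [cc ic sc]] := IH z (leq_trans (proper_card pz) ltk) rz iz.
  by exists c; split=> //; apply: subset_trans sz.
have /supp_neq0P[j jz] := z0.
have pw := supp_cancel jz sz.
have [|||c [cc ic sc]] := IH (x - (x 0 j / z 0 j) *: z).
- exact: leq_trans (proper_card pw) ltk.
- exact: rel_lin.
- move: iz ix; rewrite !in_supp !mxE => /negPn/eqP->.
  by rewrite mulr0 subr0.
by exists c; split=> //; apply: subset_trans sc (proper_sub pw).
Qed.

(** Transitivity of lying on a common circuit, by induction on the size of the union of the two
    supports. Eliminating [y] gives circuits [c1] through [x] and [c2] through [z]; one of the pairs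
    [c1], [c2] and [c1], [b] meets and has a smaller union. *)
Lemma circ_trans K a b (x z y : 'I_n) : circ K a -> circ K b ->
  x \in supp a -> z \in supp b -> y \in supp a -> y \in supp b ->
  exists c, [/\ circ K c, x \in supp c, z \in supp c &
                supp c \subset supp a :|: supp b].
Proof.
have [k] := ubnP #|supp a :|: supp b|.
elim: k a b y => // k IH a b y; rewrite ltnS => ltk ca cb xa zb ya yb.
have [xb|xb] := boolP (x \in supp b).
  by exists b; split=> //; apply: subsetUr.
have [za|za] := boolP (z \in supp a).
  by exists a; split=> //; apply: subsetUl.
have [a0 ra mina] := circP _ _ ca; have [b0 rb minb] := circP _ _ cb.
pose w := a - (a 0 y / b 0 y) *: b.
have rw : rel_word K w by apply: rel_lin.
have sw : supp w \subset supp a :|: supp b.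
  by apply: supp_lin; [apply: subsetUl | apply: subsetUr].
have yw : y \notin supp w.
  by rewrite in_supp !mxE divfK ?subrr ?eqxx // -in_supp.
have xw : x \in supp w.
  move: xb xa; rewrite !in_supp !mxE => /negPn/eqP->.
  by rewrite mulr0 subr0.
have zw : z \in supp w.
  move: za zb; rewrite !in_supp !mxE => /negPn/eqP-> bz.
  rewrite sub0r oppr_eq0 !mulf_neq0 ?invr_eq0 -?in_supp //.
  by rewrite in_supp.
have [c1 [cc1 xc1 sc1]] := circ_through rw xw.
have [c2 [cc2 zc2 sc2]] := circ_through rw zw.
have yc1 : y \notin supp c1 by apply: contra yw; apply: (subsetP sc1).
have yc2 : y \notin supp c2 by apply: contra yw; apply: (subsetP sc2).
have s1 : supp c1 \subset supp a :|: supp b by apply: subset_trans sw.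
have s2 : supp c2 \subset supp a :|: supp b by apply: subset_trans sw.
(* By minimality a circuit avoiding [y] cannot lie inside one through [y], so [c1] leaves [a] at
   some [e1] and [c2] leaves [b] at some [e2]. *)
have nsub (c d : 'rV[F]_n) : circ K c -> circ K d -> y \in supp d ->
    y \notin supp c -> exists2 e, e \in supp c & e \notin supp d.
  move=> /circP[c0 rc _] /circP[_ _ mind] yd yc.
  apply/subsetPn; apply: contra yc => sc.
  exact: (subsetP (mind c c0 rc sc)).
have [e1 e1c e1a] := nsub _ _ cc1 ca ya yc1.
have [e2 e2c e2b] := nsub _ _ cc2 cb yb yc2.
have e1b : e1 \in supp b.
  by have := subsetP s1 _ e1c; rewrite inE (negbTE e1a).
have e2a : e2 \in supp a.
  by have := subsetP s2 _ e2c; rewrite inE (negbTE e2b) orbF.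
have lift (c d : 'rV[F]_n) : supp c :|: supp d \proper supp a :|: supp b ->
    circ K c -> circ K d -> x \in supp c -> z \in supp d ->
    (exists2 e, e \in supp c & e \in supp d) ->
  exists c, [/\ circ K c, x \in supp c, z \in supp c &
                supp c \subset supp a :|: supp b].
  move=> pr cc cd xc zd [e ec ed].
  have [f [cf xf zf sf]] :=
    IH c d e (leq_trans (proper_card pr) ltk) cc cd xc zd ec ed.
  by exists f; split=> //; apply: subset_trans sf (proper_sub pr).
(* If [c1] and [c2] share [e2], their union misses [y]; otherwise [c1] and [b] share [e1] and their
   union misses [e2]. *)
have [e2c1|e2c1] := boolP (e2 \in supp c1).
  apply: (lift c1 c2) => //; last by exists e2.
  apply/properP; split; first by rewrite subUset s1.
  by exists y; rewrite inE ?ya // (negbTE yc1).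
apply: (lift c1 b) => //; last by exists e1.
apply/properP; split; first by rewrite subUset s1 subsetUr.
by exists e2; rewrite inE ?e2a // (negbTE e2c1) (negbTE e2b).
Qed.

(* The words on [supp a] that become relations after adding [u] to [K] form a
   plane spanned by [a] and some [b].  Eliminating one coordinate [k] from [b]
   with [a] gives a circuit, and the circuits obtained from two coordinates with
   different ratios [b k / a k] cover [supp a]. *)
Lemma circ_halve K u a : circ K a ->
  exists c, [/\ circ (K + <<u>>)%MS c, supp c \subset supp a &
                (#|supp a| <= 2 * #|supp c|)%N].
Proof.
move=> ca; have [a0 ra mina] := circP _ _ ca.
have ra' := rel_addl u ra.
have [ca'|] := boolP (circ (K + <<u>>)%MS a).
  by exists a; rewrite subxx leq_pmull.
rewrite /circ a0 ra' /= negb_forall => /existsP[b].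
rewrite negb_imply => /andP[/and3P[b0 rb sb] nsb].
have nab l : b != l *: a.
  apply: contra nsb => /eqP eb; apply/subsetP=> j; rewrite !in_supp eb mxE => aj.
  rewrite mulf_neq0 //; apply: contraNneq b0 => l0.
  by rewrite eb l0 scale0r.
have [mu rmu] := sub_add_lineP _ _ _ rb.
have mu0 : mu != 0.
  apply: contraTneq isT => mu0; move: rmu; rewrite mu0 scale0r subr0 => rb0.
  by have [l /eqP] := circ_uniq ca rb0 sb; rewrite (negbTE (nab l)).
have span x : rel_word (K + <<u>>)%MS x -> supp x \subset supp a ->
    exists s t, x = s *: b + t *: a.
  move=> /sub_add_lineP[l rl] sx; pose s := l / mu.
  have rx : rel_word K (x - s *: b).
    rewrite /rel_word mulmxBl -scalemxAl.
    have -> : x *m A^T - s *: (b *m A^T) =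
              (x *m A^T - l *: u) - s *: (b *m A^T - mu *: u).
      rewrite scalerBr scalerA /s divfK // opprB addrA.
      by rewrite subrK.
    by rewrite addmx_sub // eqmx_opp scalemx_sub.
  have [t et] := circ_uniq ca rx (supp_lin s sx sb).
  by exists s, t; rewrite -et addrC subrK.
pose e k := b - (b 0 k / a 0 k) *: a.
have se k : supp (e k) \subset supp a by apply: supp_lin.
have ek0 k : k \in supp a -> e k 0 k = 0.
  by rewrite in_supp => ak; rewrite !mxE divfK // subrr.
have ce k : k \in supp a -> circ (K + <<u>>)%MS (e k).
  move=> ka; apply/circP; split; first by rewrite subr_eq0.
    exact: rel_lin.
  move=> x x0 rx sx.
  have [s [t ex]] := span x rx (subset_trans sx (se k)).
  pose t' := t + s * (b 0 k / a 0 k).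
  have ex' : x = s *: e k + t' *: a.
    by rewrite ex /e scalerBr scalerA scalerDl (addrC (t *: a)) addrA subrK.
  have xk : x 0 k = 0.
    by apply: (supp_sub sx); rewrite in_supp ek0 // eqxx.
  have t0 : t' = 0.
    move: xk; rewrite ex' !mxE -/(e k) => h.
    have := ek0 k ka; rewrite !mxE => h2; move: h; rewrite h2 mulr0 add0r.
    by move/eqP; rewrite mulf_eq0 => /orP[/eqP//|ak]; rewrite in_supp ak in ka.
  move: ex'; rewrite t0 scale0r addr0 => ex'.
  apply/subsetP=> j; rewrite !in_supp ex' => ej.
  rewrite (_ : (s *: e k) 0 j = s * e k 0 j); last by rewrite !mxE.
  rewrite mulf_neq0 //.
  by apply: contraNneq x0 => s0; rewrite ex' s0 scale0r.
have /supp_neq0P[i ia] := a0.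
have : b - (b 0 i / a 0 i) *: a != 0 by rewrite subr_eq0.
case/supp_neq0P=> j ej.
have ja : j \in supp a by apply: (subsetP (se i)).
have cover : supp a \subset supp (e i) :|: supp (e j).
  apply/subsetP=> l la; rewrite inE; apply/negPn; rewrite negb_or.
  apply/negP=> /andP[]; rewrite !in_supp !negbK !mxE !subr_eq0.
  move: ej la ja; rewrite !in_supp !mxE subr_eq0 => ej la ja /eqP-> /eqP/(mulIf la) h.
  by move: ej; rewrite h divfK ?eqxx.
have := leq_trans (subset_leq_card cover) (leq_card_setU _ _).
have [le|le] := leqP #|supp (e i)| #|supp (e j)| => h.
  exists (e j); split; [exact: ce | exact: se | ].
  by apply: leq_trans h _; rewrite mul2n -addnn leq_add2r.
exists (e i); split; [exact: ce | exact: se | ].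
by apply: leq_trans h _; rewrite mul2n -addnn leq_add2l ltnW.
Qed.

(** * Circuit sizes after contracting a set of columns *)

(** The columns of [S] are contracted one by one, each costing a factor 2 by [circ_halve]. Only the
    relations of [K'] are recorded: they are those of [K] up to a word on [S]. *)
Lemma circ_contract K S a : circ K a ->
  exists K' c, [/\ forall x, rel_word K' x <->
                     exists2 y, supp y \subset S & rel_word K (x - y),
                   circ K' c, supp c \subset supp a &
                   (#|supp a| <= 2 ^ #|S| * #|supp c|)%N].
Proof.
have [k] := ubnP #|S|; elim: k S => // k IH S; rewrite ltnS => ltk ca.
have [->|/set0Pn[j jS]] := eqVneq S set0.
  exists K, a; rewrite cards0 mul1n subxx; split=> // x; split=> [rx|[y]].
    by exists 0; rewrite ?subr0 // (eqP (_ : supp 0 == set0)) ?supp_eq0.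
  by rewrite subset0 supp_eq0 => /eqP->; rewrite subr0.
have cS : #|S| = #|S :\ j|.+1 by rewrite (cardsD1 j S) jS.
have [|K1 [c1 [h1 cc1 sc1 le1]]] := IH (S :\ j) _ ca; first by rewrite -cS.
have [c [cc sc le]] := circ_halve (delta_mx 0 j *m A^T) cc1.
exists (K1 + <<(delta_mx 0 j : 'rV[F]_n) *m A^T>>)%MS, c; split=> //; last 2 first.
- exact: subset_trans sc sc1.
- by rewrite cS expnSr -mulnA (leq_trans le1) // leq_mul2l le orbT.
have sj : supp (delta_mx 0 j : 'rV[F]_n) \subset S by rewrite supp_delta sub1set.
move=> x; split=> [/rel_add_wordP[l /h1[y sy ry]]|[y sy ry]].
  exists (y - (- l) *: delta_mx 0 j).
    by apply: supp_lin sj; apply: subset_trans sy (subD1set _ _).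
  by rewrite scaleNr opprK opprD addrA addrAC.
(* The last contraction absorbs the coordinate of [y] at [j], leaving a word on the other columns of
   [S]. *)
apply/rel_add_wordP; exists (y 0 j); apply/h1.
exists (y - y 0 j *: delta_mx 0 j); last by rewrite opprB addrA subrK.
apply: suppP => i; rewrite !inE negb_and negbK => /orP[/eqP->|iS].
  by rewrite !mxE !eqxx mulr1 subrr.
rewrite !mxE (supp_sub sy iS) eqxx /=.
by case: eqP iS => [->|_ _]; rewrite ?jS // mulr0 subr0.
Qed.

Definition circ_bounded K E L : Prop :=
  forall a, circ K a -> supp a \subset E -> (#|supp a| <= L)%N.

(** Contracting all of [S] absorbs [b *m A^T], so the result is the same as contracting [S] from
    [K]. There [circ_contract] finds a circuit [c] at most [2 ^ #|S|] times smaller than [a], and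
    [c] is either a single column or covered by a circuit of [K]. *)
Lemma circ_bounded_add K E L S b :
  circ_bounded K E L -> (0 < L)%N -> S \subset E -> supp b \subset S ->
  circ_bounded (K + <<b *m A^T>>)%MS E (2 ^ #|S| * L).
Proof.
move=> bd L0 sSE sb a ca saE.
have [K' [c [hK' cc sca le]]] := circ_contract S ca.
apply: leq_trans le _; rewrite leq_mul2l; apply/orP; right.
have hK x : rel_word K' x <-> exists2 y, supp y \subset S & rel_word K (x - y).
  split=> [/hK'[y sy /rel_add_wordP[l ry]]|[y sy ry]]; last first.
    by apply/hK'; exists y => //; apply: rel_addl.
  exists (y - (- l) *: b); first exact: supp_lin.
  by rewrite scaleNr opprK opprD addrA.
have [c0 rc minc] := circP _ _ cc.
have [disj|] := boolP [disjoint supp c & S]; last first.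
  (* A column of [S] is a loop after the contraction, so a circuit meeting [S] is that one
     column. *)
  case/pred0Pn=> i /andP[/= ic iS].
  have := minc (delta_mx 0 i); rewrite -supp_eq0 supp_delta sub1set => min.
  rewrite (leq_trans _ L0) // -(cards1 i) subset_leq_card // min //.
    by apply/set0Pn; exists i; rewrite inE.
  apply/hK; exists (delta_mx 0 i); first by rewrite supp_delta sub1set.
  by rewrite subrr /rel_word mul0mx sub0mx.
have /supp_neq0P[i ic] := c0.
have iS : i \notin S by rewrite (disjointFr disj ic).
have [y sy ry] := (hK c).1 rc.
have sE : supp (c - y) \subset E.
  rewrite -[y]scale1r; apply: supp_lin; last exact: subset_trans sSE.
  exact: subset_trans saE.
have ixy : i \in supp (c - y).
  by move: ic; rewrite !in_supp !mxE (supp_sub sy iS) subr0.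
have [d [cd id sd]] := circ_through ry ixy.
(* Clearing the coordinates in [S] changes [d] by a word on [S], so [e] is a relation of [K'], and
   minimality of [c] puts [supp c] inside [supp e]. *)
pose e := \row_j (if j \in S then 0 else d 0 j) : 'rV[F]_n.
have ie : i \in supp e by rewrite in_supp mxE (negbTE iS) -in_supp.
have [_ rd _] := circP _ _ cd.
apply: (leq_trans _ (bd d cd (subset_trans sd sE))).
apply: subset_leq_card; apply: (@subset_trans _ _ (supp e)).
  apply: minc; first by apply/supp_neq0P; exists i.
    apply/hK; exists (e - d).
      apply: suppP => j jS; by rewrite !mxE (negbTE jS) subrr.
    by rewrite opprB addrC subrK.
  apply/subsetP=> j; rewrite in_supp mxE.
  have [|jS dj] := boolP (j \in S); first by rewrite eqxx.
  have := subsetP sd j; rewrite !in_supp !mxE (supp_sub sy jS) subr0.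
  exact.
apply/subsetP=> j; rewrite !in_supp mxE.
by case: (j \in S) => //; rewrite eqxx.
Qed.

End Words.

(** * Depth and its dependence on the subspace *)

Section Depth.
Variables (F : finFieldType) (m n : nat) (A : 'M[F]_(m, n)).
Implicit Types (a b c x y : 'rV[F]_n) (K : 'M[F]_m) (u : 'rV[F]_m).
Implicit Types (S T E C D : {set 'I_n}) (i j : 'I_n).

(** Equivalently, [K] and [K'] meet the span of the columns in [S] in the same subspace; the matroid
    and the depth on [S] depend on nothing else. *)
Definition eq_words S K K' : Prop :=
  forall a, supp a \subset S -> rel_word A K a = rel_word A K' a.

Lemma eq_wordsW S T K K' : T \subset S -> eq_words S K K' -> eq_words T K K'.
Proof. by move=> sTS h a sa; apply: h; apply: subset_trans sTS. Qed.

Lemma eq_words_sym S K K' : eq_words S K K' -> eq_words S K' K.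
Proof. by move=> h a /h. Qed.

Lemma mdependent_eq S K K' T : eq_words S K K' -> T \subset S ->
  mdependent A K T = mdependent A K' T.
Proof.
move=> h sT; apply/mdependentP/mdependentP => -[a [a0 sa ra]]; exists a; split=> //.
  by rewrite -h // (subset_trans sa).
by rewrite h // (subset_trans sa).
Qed.

Lemma mcircuit_eq S K K' C : eq_words S K K' -> C \subset S ->
  mcircuit A K C = mcircuit A K' C.
Proof.
move=> h sC; rewrite /mcircuit (mdependent_eq h sC); congr (_ && _).
apply: eq_forallb => C'; case pC: (C' \proper C) => //=.
by rewrite (mdependent_eq h) // (subset_trans (proper_sub pC)).
Qed.

Lemma mconnected_eq S K K' E : eq_words S K K' -> E \subset S ->
  mconnected A K E = mconnected A K' E.
Proof.
move=> h sE; apply: eq_forallb => i; case: (i \in E) => //=.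
apply: eq_forallb => j; case: (j \in E) => //=; case: (i != j) => //=.
apply: eq_existsb => C; case sC: (C \subset E) => //=.
by rewrite (mcircuit_eq h) // (subset_trans sC).
Qed.

(* Quantifying over all connected subsets, instead of over the components of a
   disconnected set, makes monotonicity in [E] immediate; see [csd_leE]. *)
Fixpoint csdl (d : nat) E K : bool :=
  match d with
  | 0 => [forall j in E, rel_word A K (delta_mx 0 j)]
  | d'.+1 => [forall C : {set 'I_n}, (C \subset E) && mconnected A K C ==>
               [exists u : 'rV[F]_m, csdl d' C (K + <<u>>)%MS]]
  end.

Lemma csdlSP d E K :
  reflect (forall C, C \subset E -> mconnected A K C ->
             exists u, csdl d C (K + <<u>>)%MS)
          (csdl d.+1 E K).
Proof.
apply: (iffP forallP) => h C.
  by move=> sC cC; apply/existsP; apply: (implyP (h C)); rewrite sC.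
by apply/implyP=> /andP[sC cC]; apply/existsP; apply: h.
Qed.

Lemma csdl_sub d E E' K : E' \subset E -> csdl d E K -> csdl d E' K.
Proof.
case: d => [|d] sE.
  by move=> /forall_inP h; apply/forall_inP=> j /(subsetP sE); apply: h.
by move=> /csdlSP h; apply/csdlSP=> C /subset_trans sC; apply: h; apply: sC.
Qed.

Lemma eq_words_add S K K' b : supp b \subset S -> eq_words S K K' ->
  eq_words S (K + <<b *m A^T>>)%MS (K' + <<b *m A^T>>)%MS.
Proof.
move=> sb h a sa; apply/rel_add_wordP/rel_add_wordP => -[l rl]; exists l;
  by move: rl; rewrite h // supp_lin.
Qed.

Lemma eq_words_cong S K u (w : 'rV[F]_m) : (w - u <= K)%MS ->
  eq_words S (K + <<u>>)%MS (K + <<w>>)%MS.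
Proof.
move=> wu a _; apply/sub_add_lineP/sub_add_lineP => -[l rl]; exists l.
  have -> : a *m A^T - l *: w = (a *m A^T - l *: u) - l *: (w - u).
    by rewrite scalerBr opprB addrA subrK.
  by rewrite addmx_sub // eqmx_opp scalemx_sub.
have -> : a *m A^T - l *: u = (a *m A^T - l *: w) + l *: (w - u).
  by rewrite scalerBr addrA subrK.
by rewrite addmx_sub // scalemx_sub.
Qed.

(** A new relation on [S] uses [u] with a nonzero coefficient, and dividing by that coefficient
    expresses [u] modulo [K] through the columns in [S]. *)
Lemma span_or_eq_words S K u :
  (exists2 b, supp b \subset S & (b *m A^T - u <= K)%MS)
  \/ eq_words S (K + <<u>>)%MS K.
Proof.
have [/existsP[b /andP[sb rb]]|/existsPn nb] :=
  boolP [exists b : 'rV[F]_n, (supp b \subset S) && (b *m A^T - u <= K)%MS].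
  by left; exists b.
right=> a sa; apply/idP/idP => [/sub_add_lineP[l rl]|]; last exact: rel_addl.
have [l0|l0] := eqVneq l 0; first by move: rl; rewrite l0 scale0r subr0.
have /negP[] := nb (l^-1 *: a); apply/andP; split.
  by apply: suppP => j jS; rewrite mxE (supp_sub sa jS) mulr0.
rewrite -scalemxAl -[u]scale1r -(mulVf l0) -scalerA -scalerBr.
exact: scalemx_sub.
Qed.

Lemma eq_words_add0 S K : eq_words S (K + <<(0 : 'rV[F]_m)>>)%MS K.
Proof. by move=> a _; rewrite /rel_word genmx0 addsmx0. Qed.

(** The vector chosen for [K] need not serve [K'], since the two agree only on the span of [S]. It
    is replaced by a congruent vector in the span of [C], or by 0 when contracting it has no effect
    on [C]. *)
Lemma csdl_eq d S K K' : eq_words S K K' -> csdl d S K -> csdl d S K'.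
Proof.
elim: d S K K' => [|d IH] S K K' h.
  move=> /forall_inP h0; apply/forall_inP=> j jS.
  by rewrite -h ?supp_delta ?sub1set //; apply: h0.
move=> /csdlSP h0; apply/csdlSP=> C sC cC.
have hC := eq_wordsW sC h.
have [|u hu] := h0 C sC; first by rewrite (mconnected_eq hC).
have [[b sb eb]|e0] := span_or_eq_words C K u.
  exists (b *m A^T); apply: IH hu => a sa.
  by rewrite (eq_words_cong eb sa); apply: eq_words_add hC a sa.
exists 0; apply: IH hu => a sa; rewrite e0 // hC //.
by rewrite (eq_words_add0 K' sa).
Qed.

Lemma csdl_line0 d E K : csdl d E K -> csdl d E (K + <<(0 : 'rV[F]_m)>>)%MS.
Proof. apply: csdl_eq; apply: eq_words_sym; apply: eq_words_add0. Qed.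

Lemma csdlS d E K : csdl d E K -> csdl d.+1 E K.
Proof.
elim: d E K => [|d IH] E K h; apply/csdlSP=> C sC cC.
  by exists 0; apply: csdl_line0; apply: csdl_sub sC _.
by have /csdlSP/(_ C sC cC)[u /IH] := h; exists u.
Qed.

Lemma csdl_leq d d' E K : (d <= d')%N -> csdl d E K -> csdl d' E K.
Proof. by move/subnK <-; elim: (d' - d)%N => // k IH /IH; apply: csdlS. Qed.

(** * Agreement with the recursive definition of depth *)

Lemma mrank0E K E : (mrank A K E == 0)%N = csdl 0 E K.
Proof.
rewrite -leqn0; apply/bigmax_leqP/forall_inP => [h j jE|h S /andP[sS indS]].
  have := h [set j]; rewrite sub1set jE cards1 /=.
  case: mdependentP => [[a [/supp_neq0P[i ia] sa ra]] _|_]; last by move=> /(_ isT).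
  have ij : i = j by apply/set1P; apply: (subsetP sa).
  subst i; rewrite in_supp in ia.
  have -> : delta_mx 0 j = (a 0 j)^-1 *: a.
    apply/rowP=> i; rewrite !mxE eqxx /=; case: eqP => [->|/eqP ij].
      by rewrite mulVf.
    by rewrite (supp_sub sa (_ : i \notin [set j])) ?mulr0 ?inE.
  by rewrite /rel_word -scalemxAl scalemx_sub.
rewrite leqn0 cards_eq0; apply: contraNT indS => /set0Pn[j jS].
apply/mdependentP; exists (delta_mx 0 j); split.
- by rewrite -supp_eq0 supp_delta; apply/set0Pn; exists j; rewrite inE.
- by rewrite supp_delta sub1set.
- by apply: h; apply: (subsetP sS).
Qed.

Lemma mconnected1 K j : mconnected A K [set j].
Proof.
by apply/forall_inP=> x /set1P->; apply/forall_inP=> y /set1P->; rewrite eqxx.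
Qed.

Lemma mcomponent_ex K E C : C \subset E -> mconnected A K C ->
  exists2 D : {set 'I_n}, C \subset D & mcomponent A K E D.
Proof.
move=> sC cC.
have P : (C \subset E) && mconnected A K C by rewrite sC.
have [D /maxsetP[/andP[sD cD] maxD] sCD] :=
  @maxset_exists _ (fun D : {set 'I_n} => (D \subset E) && mconnected A K D) C P.
exists D => //; apply/and3P; split=> //; apply/forallP=> C'.
apply/implyP=> /andP[pD sC']; apply/negP=> cC'.
have := maxD C'; rewrite sC' cC' (proper_sub pD) => /(_ isT isT) e.
by rewrite e properxx in pD.
Qed.

(** The inner loop of [csd_le] with its connected case abstracted into [P], so that depth zero and
    successor depth share one unfolding. *)
Definition csd_aux (P : {set 'I_n} -> bool) K : nat -> {set 'I_n} -> bool :=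
  fix aux f E := match f with
  | 0 => false
  | f'.+1 => (mrank A K E == 0)%N ||
     (if mconnected A K E then P E
      else [forall C : {set 'I_n}, mcomponent A K E C ==> aux f' C])
  end.

(** Every connected subset extends to a component, and [P] is inherited by subsets, so testing
    components amounts to testing connected subsets. Components of a disconnected set are strictly
    smaller, so the fuel suffices. *)
Lemma csd_auxE (P : {set 'I_n} -> bool) K f E :
  (forall C D, C \subset D -> P D -> P C) -> (#|E| < f)%N ->
  csd_aux P K f E =
  [forall C : {set 'I_n}, (C \subset E) && mconnected A K C ==>
                          (mrank A K C == 0)%N || P C].
Proof.
move=> Psub; elim: f E => // f IH E; rewrite ltnS => ltE /=.
rewrite -/(csd_aux P K).
have [r0|r0] /= := boolP (_ == 0)%N.
  apply/esym/forallP=> C; apply/implyP=> /andP[sC _]; apply/orP; left.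
  by move: r0; rewrite !mrank0E; apply: csdl_sub.
have [cE|ncE] := boolP (mconnected A K E).
  apply/idP/forallP => [PE C|/(_ E)]; last by rewrite subxx cE (negbTE r0).
  by apply/implyP=> /andP[sC _]; rewrite (Psub C E) ?orbT.
have ltC C : mcomponent A K E C -> (#|C| < f)%N.
  case/and3P=> sC cC _; apply: leq_trans ltE; apply: proper_card.
  by rewrite properEneq sC andbT; apply: contraNneq ncE => <-.
apply/forallP/forallP => h C; apply/implyP.
  case/andP=> sC cC; have [D sCD cD] := mcomponent_ex sC cC.
  have := implyP (h D) cD; rewrite IH ?ltC // => /forallP/(_ C).
  by rewrite sCD cC.
move=> cC; rewrite IH ?ltC //; apply/forallP=> D; apply/implyP=> /andP[sD cD].
have /and3P[sC _ _] := cC.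
by apply: (implyP (h D)); rewrite (subset_trans sD).
Qed.

Lemma csd_leE d E K : csd_le A d E K = csdl d E K.
Proof.
elim: d E K => [|d IH] E K.
  rewrite (_ : csd_le A 0 E K = csd_aux (fun=> false) K #|E|.+1 E) //.
  rewrite csd_auxE //; apply/forallP/forall_inP => [h j jE|h C].
    have := h [set j]; rewrite sub1set jE mconnected1 orbF mrank0E /=.
    by move=> /forall_inP; apply; rewrite inE.
  apply/implyP=> /andP[sC _]; rewrite orbF mrank0E.
  by apply: csdl_sub sC _; apply/forall_inP.
rewrite (_ : csd_le A d.+1 E K = csd_aux
  (fun C => [exists u : 'rV[F]_m, csd_le A d C (K + <<u>>)%MS]) K #|E|.+1 E) //.
rewrite csd_auxE // => [|C D sC /existsP[u]]; last first.
  by rewrite IH => /(csdl_sub sC) h; apply/existsP; exists u; rewrite IH.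
apply: eq_forallb => C; congr (_ ==> _).
apply/orP/existsP => [[|/existsP[u]]|[u hu]].
(* [csdl] asks for a vector even in rank 0; the zero vector serves. *)
- rewrite mrank0E => h; exists 0; apply: csdl_line0; exact: csdl_leq h.
- by rewrite IH; exists u.
- by right; apply/existsP; exists u; rewrite IH.
Qed.

(** * Circuit sizes and small connected sets *)

(** The support of a circuit is itself connected, so the recursion supplies a vector for it, and
    [circ_halve] bounds the loss by 2 at each level. *)
Lemma csdl_circ_bounded d E K : csdl d E K -> circ_bounded A K E (2 ^ d).
Proof.
elim: d E K => [|d IH] E K h a ca saE.
  have [/supp_neq0P[i ia] _ mina] := circP _ _ _ ca.
  rewrite expn0 -(cards1 i) subset_leq_card // -(supp_delta F i) mina //.
  - by rewrite -supp_eq0 supp_delta; apply/set0Pn; exists i; rewrite inE.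
  - by apply: (forall_inP h); apply: (subsetP saE).
  - by rewrite supp_delta sub1set.
have cC : mconnected A K (supp a).
  apply/forall_inP=> i ia; apply/forall_inP=> j ja; apply/implyP=> _.
  apply/existsP; exists (supp a); rewrite subxx ia ja !andbT.
  by apply/mcircuitP; exists a.
have /csdlSP/(_ _ saE cC)[u hu] := h.
have [c [cc sc le]] := circ_halve u ca.
by rewrite (leq_trans le) // expnS leq_mul2l /=; apply: IH hu _ _ _.
Qed.

(** The case [i = j] keeps the relation reflexive at columns lying in no circuit. *)
Definition linked K S i j : Prop :=
  i = j \/ exists a, [/\ circ A K a, supp a \subset S, i \in supp a & j \in supp a].

Lemma mconnectedP K S :
  reflect (forall i j, i \in S -> j \in S -> linked K S i j) (mconnected A K S).
Proof.
apply: (iffP forall_inP) => h i; last first.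
  move=> iS; apply/forall_inP=> j jS; apply/implyP=> ij.
  have [e|[a [ca sa ia ja]]] := h i j iS jS; first by rewrite e eqxx in ij.
  apply/existsP; exists (supp a); rewrite sa ia ja !andbT /=.
  by apply/mcircuitP; exists a.
move=> j iS jS; have [->|ij] := eqVneq i j; first by left.
right; have /forall_inP/(_ j jS) := h i iS; rewrite ij => /existsP[C].
by case/and4P=> sC /mcircuitP[a ca ea] iC jC; exists a; rewrite ea.
Qed.

Lemma linked_sub K S T i j : S \subset T -> linked K S i j -> linked K T i j.
Proof.
move=> sST [->|[a [ca sa ia ja]]]; [by left | right].
by exists a; split=> //; apply: subset_trans sST.
Qed.

Lemma linked_sym K S i j : linked K S i j -> linked K S j i.
Proof. by move=> [->|[a [ca sa ia ja]]]; [left | right; exists a]. Qed.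

Lemma linked_trans K S j i k : linked K S i j -> linked K S j k -> linked K S i k.
Proof.
move=> [->//|[a [ca sa ia ja]]] [<-|[b [cb sb jb kb]]]; right.
  by exists a.
have [c [cc ic kc sc]] := circ_trans ca cb ia kb ja jb.
by exists c; split=> //; apply: subset_trans sc _; rewrite subUset sa.
Qed.

Lemma leq_card_bigcup (I : finType) (P : {set I}) (D : I -> {set 'I_n}) L :
  (forall s, s \in P -> #|D s| <= L)%N -> (#|\bigcup_(s in P) D s| <= #|P| * L)%N.
Proof.
move=> h; rewrite -sum_nat_const; apply: leq_trans (leq_sum _ h).
elim/big_rec2: _ => [|i k X _ le]; first by rewrite cards0.
by apply: leq_trans (leq_card_setU _ _) _; rewrite leq_add2l.
Qed.

Lemma connected_hull K E S L :
  mconnected A K E -> circ_bounded A K E L -> (0 < L)%N -> S \subset E ->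
  exists T, [/\ S \subset T, T \subset E, mconnected A K T & (#|T| <= #|S| * L)%N].
Proof.
move=> /mconnectedP cE bd L0 sSE.
have [S0|/set0Pn[r rS]] := eqVneq S set0.
  exists set0; rewrite S0 subxx sub0set cards0; split=> //.
  by apply/mconnectedP=> i j; rewrite inE.
have /fin_all_exists[D hD] s : exists D, s \in S ->
    [/\ D \subset E, s \in D, (#|D| <= L)%N &
        forall j, j \in D -> linked K D j r].
  have [sS|_] := boolP (s \in S); last by exists set0.
  have [<-|[a [ca sa sia ria]]] := cE s r (subsetP sSE s sS) (subsetP sSE r rS).
    exists [set s] => _; rewrite sub1set inE eqxx cards1 (subsetP sSE) //.
    by split=> // j /set1P->; left.
  exists (supp a) => _; split=> //; first exact: bd.
  by move=> j ja; right; exists a.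
exists (\bigcup_(s in S) D s); split.
- by apply/subsetP=> s sS; apply/bigcupP; exists s => //; case: (hD s sS).
- by apply/bigcupsP=> s sS; case: (hD s sS).
- apply/mconnectedP=> i j /bigcupP[s sS iD] /bigcupP[t tS jD].
  have [_ _ _ hs] := hD s sS; have [_ _ _ ht] := hD t tS.
  apply: (@linked_trans _ _ r); first exact: linked_sub (bigcup_sup s sS) (hs i iD).
  exact/linked_sym/(linked_sub (bigcup_sup t tS))/(ht j jD).
- by apply: leq_card_bigcup => s sS; case: (hD s sS).
Qed.

(** * Bounded certificates of large depth *)

(** Here [s] bounds a certificate before contraction, [q ^ s] counts the words on it, and each word
    adds a certificate for circuit bound [2 ^ s * L]. The final factor [L] pays for connecting
    them. *)
Fixpoint obstruction_bound (q t L : nat) : nat :=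
  match t with
  | 0 => 1
  | t'.+1 => let s := obstruction_bound q t' L in
             (s + q ^ s * obstruction_bound q t' (2 ^ s * L)) * L
  end.

(* A set [S] certifying depth greater than [t] after no contraction keeps doing
   so after contracting any [u] outside its span.  Only boundedly many [u] are
   left; each of them gets its own certificate, and boundedly many circuits
   connect the union of all these certificates. *)
Lemma small_obstruction t L K E :
  circ_bounded A K E L -> (0 < L)%N -> ~~ csdl t E K ->
  exists S, [/\ S \subset E, (#|S| <= obstruction_bound #|F| t L)%N & ~~ csdl t S K].
Proof.
elim: t L K E => [|t IH] L K E bd L0.
  rewrite /= negb_forall => /existsP[j]; rewrite negb_imply => /andP[jE nj].
  exists [set j]; rewrite sub1set jE cards1; split=> //.
  by apply: contra nj => /forall_inP; apply; rewrite inE.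
rewrite [csdl _ _ _]/= negb_forall => /existsP[C]; rewrite negb_imply.
case/andP=> /andP[sCE cC] /existsPn nC.
have bdC : circ_bounded A K C L by move=> a ca sa; apply: bd (subset_trans sa sCE).
(* Contracting the zero vector changes nothing, so [nC] at 0 shows that [C] itself has depth above
   [t]. *)
have [|S0 [sS0 leS0 nS0]] := IH L K C bdC L0.
  by apply: contra (nC 0); apply: csdl_line0.
set s := obstruction_bound #|F| t L in leS0.
have /fin_all_exists[D hD] b : exists D, supp b \subset S0 ->
    [/\ D \subset C, (#|D| <= obstruction_bound #|F| t (2 ^ s * L))%N &
        ~~ csdl t D (K + <<b *m A^T>>)%MS].
  have [sb|_] := boolP (supp b \subset S0); last by exists set0.
  have [||D hD] := IH (2 ^ s * L)%N (K + <<b *m A^T>>)%MS C _ _ (nC _).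
  - move=> a ca sa; apply: leq_trans (circ_bounded_add bdC L0 sS0 sb ca sa) _.
    by rewrite leq_mul2r leq_exp2l // leS0 orbT.
  - by rewrite muln_gt0 expn_gt0.
  by exists D.
pose W := [set b : 'rV[F]_n | supp b \subset S0].
pose S1 := S0 :|: \bigcup_(b in W) D b.
have sS1 : S1 \subset C.
  by rewrite subUset sS0; apply/bigcupsP=> b; rewrite inE => /hD[].
have leS1 : (#|S1| <= s + #|F| ^ s * obstruction_bound #|F| t (2 ^ s * L))%N.
  apply: leq_trans (leq_card_setU _ _) _; apply: leq_add => //.
  apply: (@leq_trans (#|W| * obstruction_bound #|F| t (2 ^ s * L))).
    by apply: leq_card_bigcup => b; rewrite inE => /hD[].
  rewrite leq_mul2r; apply/orP; right.
  apply: (@leq_trans (#|F| ^ #|S0|)); first exact: card_words.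
  by rewrite leq_pexp2l // ltnW // card_finNzRing_gt1.
have [T [sS1T sTC cT leT]] := connected_hull cC bdC L0 sS1.
exists T; split.
- exact: subset_trans sCE.
- by apply: leq_trans leT _; rewrite leq_mul2r leS1 orbT.
(* Since [T] is connected, the recursion would give a vector [u] for [T] itself; it is refuted on
   some [D b] or on [S0]. *)
apply/negP=> /csdlSP/(_ T (subxx _) cT)[u hu].
have [[b sb eb]|e0] := span_or_eq_words S0 K u.
  have [_ _ /negP[]] := hD b sb.
  apply: csdl_eq (eq_words_cong eb) (csdl_sub _ hu).
  apply: subset_trans sS1T; apply: subset_trans (subsetUr _ _).
  by apply: bigcup_sup; rewrite inE.
case/negP: nS0; apply: csdl_eq e0 (csdl_sub _ hu).
by apply: subset_trans sS1T; apply: subsetUl.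
Qed.

(** * Counting progressive vectors *)

Lemma progressive_bound d : csd_is A d setT 0 ->
  (#|[set v : 'rV[F]_m | progressive A d v]|
    <= #|F| ^ obstruction_bound #|F| d.-1 (2 ^ d))%N.
Proof.
case: d => [|d] /andP[].
  (* Nothing lies below depth 0, so no vector is progressive. *)
  move=> _ _; rewrite (_ : [set v | _] = set0) ?cards0 //.
  by apply/setP=> v; rewrite !inE; apply/existsP=> -[[]].
rewrite csd_leE => hd /forallP/(_ ord_max); rewrite csd_leE => nd.
have [S [_ leS nS]] :=
  small_obstruction (csdl_circ_bounded hd) (expn_gt0 2 d.+1) nd.
apply: (@leq_trans #|[set b *m A^T | b in [set b : 'rV[F]_n | supp b \subset S]]|).
  apply: subset_leq_card; apply/subsetP=> v; rewrite inE => /existsP[d' hv].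
  have {}hv : csdl d setT ((0 : 'M[F]_m) + <<v>>)%MS.
    have h : csdl d setT <<v>>%MS.
      by apply: (@csdl_leq d'); [rewrite -ltnS | rewrite -csd_leE].
    by apply: csdl_eq _ h => a _; rewrite /rel_word adds0mx.
  have [[b sb]|e0] := span_or_eq_words S 0 v.
    by rewrite submx0 subr_eq0 => /eqP<-; apply: imset_f; rewrite inE.
  by case/negP: nS; apply: csdl_eq e0 (csdl_sub _ hv); apply: subsetT.
apply: leq_trans (leq_imset_card _ _) _; apply: leq_trans (card_words _ _) _.
by rewrite leq_pexp2l // ltnW // card_finNzRing_gt1.
Qed.

End Depth.

Theorem theorem6 :
  exists g : nat -> nat -> nat,
    forall (F : finFieldType) (m n : nat) (A : 'M[F]_(m, n)) (d : nat),
      csd_is A d setT 0 ->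
      (#|[set v : 'rV[F]_m | progressive A d v]| <= g #|F| d)%N.
Proof.
by exists (fun q d => q ^ obstruction_bound q d.-1 (2 ^ d))%N => *;
   apply: progressive_bound.
Qed.
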